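(* Suppose $\pi \in \mathcal{S}_n$ where $n \geq 4$. Then $\pi \in \mathcal{P}_{2,n}$ if and only if one of the following is true: 1. $\pi = 1 \oplus \hat{\pi}$ where $\hat{\pi} \in \mathcal{P}_{2,n-1}$; 2. $\pi_i=1$ for some $i \geq 2$, where $\pi_1 \cdots \pi_{i-1}$ is the longest decreasing prefix of $\pi_1\cdots \pi_{i-1}\pi_{i+1}\cdots \pi_n$, and $\hat{\pi} = \operatorname{red}(\pi_1\cdots \pi_{i-1}\pi_{i+1}\cdots \pi_n) \in \mathcal{P}_{2,n-1}$; 3. $\pi_1\pi_2\pi_3=312$ and $\hat{\pi}=\operatorname{red}(\pi_{4}\cdots \pi_n) \in \mathcal{P}_{2,n-3}$; 4. $\pi_1\pi_2\pi_3=413$, the word $\pi_{4}\cdots \pi_n$ begins with a decreasing prefix of length at least $2$ that ends in the digit $2$, and $\hat{\pi}=\operatorname{red}(\pi_{4}\cdots \pi_n) \in \mathcal{P}_{2,n-3}$; 5. $\pi=2\,\pi_2\,1\,(\pi_2-1)\,\pi_5\cdots \pi_n$ where $\pi_5>\pi_2$ (this inequality being vacuous when $n=4$) and $\operatorname{red}(\pi_2\pi_5\cdots \pi_n)\in \mathcal{P}_{2,n-3}$; 6. $\pi=2\,\pi_2\cdots \pi_{i-1}\,1\,\pi_{i+1}\cdots \pi_n$ for some $i\geq 3$, where $\pi_2\cdots \pi_{i-1}$ is decreasing and $\operatorname{red}(\pi_2\cdots \pi_{i-1}\pi_{i+1}\cdots \pi_n)\in \mathcal{P}_{2,n-2}$,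 and if $i=3$, then $\pi_2<\pi_4$.
   Context: $\mathcal{S}_n$ is the set of permutations of $\{1,\dots,n\}$, written as words $\pi_1\cdots\pi_n$. For a word $w$ of distinct integers, the reduction $\operatorname{red}(w)$ is the permutation obtained by replacing the $i$th smallest letter of $w$ with $i$. For $\alpha\in\mathcal{S}_j$ and $\beta\in\mathcal{S}_\ell$, the direct sum $\alpha\oplus\beta\in\mathcal{S}_{j+\ell}$ is the concatenation of $\alpha$ with $\beta$ where all letters of $\beta$ are incremented by $j$. Pop stack operator: for a word $\pi=\pi_1\cdots\pi_n$ of distinct integers with longest decreasing prefix $\pi_1\cdots\pi_i$, define recursively $P(\pi)=\pi_i\pi_{i-1}\cdots\pi_1\,P(\pi_{i+1}\cdots\pi_n)$, with $P$ of the empty word being empty. So $P$ reverses each maximal contiguous decreasing run. $\pi\in\mathcal{S}_n$ is two-pop-stack sortable if $P(P(\pi))=12\cdots n$, and $\mathcal{P}_{2,n}$ is the set of two-pop-stack sortable permutations in $\mathcal{S}_n$.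
   Formalization: In item 6, π_2⋯π_{i-1} is required to be the longest decreasing prefix of π_2⋯π_{i-1}π_{i+1}⋯π_n, not merely decreasing; as literally stated item 6 admits 25413, which is not two-pop-stack sortable. *)

(* Defs.v *)
From mathcomp Require Import all_boot.

Set Implicit Arguments.
Unset Strict Implicit.
Unset Printing Implicit Defensive.

(* Words are sequences of natural numbers; permutations of {1, ..., n} are
   represented by their one-line words. *)

Definition Sn (n : nat) : pred (seq nat) := fun w => perm_eq w (iota 1 n).

Definition red (w : seq nat) : seq nat :=
  [seq (index x (sort leq w)).+1 | x <- w].

Definition dsum (a b : seq nat) : seq nat := a ++ [seq size a + x | x <- b].

(* The longest strictly decreasing prefix of w. *)
Fixpoint ldp (w : seq nat) : seq nat :=
  if w is x :: w' then
    x :: (if w' is y :: _ then if y < x then ldp w' else [::] else [::])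
  else [::].

(* k is fuel: each round consumes a nonempty prefix of a nonempty w, so
   k = size w suffices, and popE is the intended recursive definition. *)
Fixpoint pop_rec (k : nat) (w : seq nat) : seq nat :=
  if k is k'.+1 then rev (ldp w) ++ pop_rec k' (drop (size (ldp w)) w)
  else [::].

Definition pop (w : seq nat) : seq nat := pop_rec (size w) w.

Definition P2 (n : nat) : pred (seq nat) :=
  fun w => (w \in Sn n) && (pop (pop w) == iota 1 n).

Lemma ldp_prefix w : prefix (ldp w) w.
Proof.
elim: w => [|x [|y w] IH] //=; first by rewrite eqxx.
by case: (y < x); rewrite /= eqxx.
Qed.

Lemma ldp_sorted w : sorted gtn (ldp w).
Proof.
elim: w => [|x [|y w] IH] //.
move: IH; rewrite /=; case: (ltnP y x) => //= lt_yx.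
by rewrite lt_yx.
Qed.

Lemma ldp_longest w s : prefix s w -> sorted gtn s -> size s <= size (ldp w).
Proof.
elim: w s => [|x w IH] [|z s] //= /andP[/eqP-> pre_s].
case: w IH pre_s => [|y w] IH; first by case: s.
case: s => [|t s] // pre_s /= /andP[lt_tx srt].
have /eqP eq_ty : t == y by case/andP: pre_s.
have := IH _ pre_s srt.
by rewrite -eq_ty lt_tx.
Qed.

Lemma pop_nil : pop [::] = [::].
Proof. by []. Qed.

Lemma popE w : pop w = rev (ldp w) ++ pop (drop (size (ldp w)) w).
Proof.
have enough k v : size v <= k -> pop_rec k v = pop v.
  rewrite /pop; elim/ltn_ind: k v => -[|k] IH [|x v] //= le_v.
    by rewrite IH.
  set d := drop _ v.
  have le_d : size d <= size v by rewrite size_drop leq_subr.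
  rewrite (IH k) ?(leq_trans le_d) //.
  by rewrite (IH (size v)).
case: w => [|x w] //.
rewrite {1}/pop /= enough // size_drop leq_subr //.
Qed.

(* Main.v *)
Require Import Defs.
From mathcomp Require Import all_boot.
From mathcomp Require Import zify.

Set Implicit Arguments.
Unset Strict Implicit.
Unset Printing Implicit Defensive.

(** Call a word layered if [pop] sorts it, so that a word is sortable when
    [pop] sends it to a layered word.  In a layered word, a letter that precedes
    a smaller one lies with it in one decreasing run, and everything after that
    run is larger than the run.  Write the word as [u ++ 1 :: v].  For
    [pop (u ++ 1 :: v)] to be layered, at most one letter may come before 1 in
    it, so either [u] is decreasing, or [u = 2 :: u'] with [u'] decreasing; in
    both cases what remains is that [rev u ++ pop v] (with [u'] for [u] in the
    second case) is layered.  If the last letter of [u] is below the first of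
    [v], this word is [pop (u ++ v)].  Otherwise a descent occurs at the junction,
    which forces [u = [:: c]] and [v = b :: w] with [b < c] and [b] below the
    first letter of [w]; the word is then [c :: b :: pop w], whose first run is
    either [c b] or [c b l] with [l] the first letter of [pop w]. *)

(** * Longest decreasing prefixes and the recursion of [pop] over runs *)

Lemma ldp_cons2 x y w : ldp (x :: y :: w) = x :: (if y < x then ldp (y :: w) else [::]).
Proof. by []. Qed.

(** Runs are strictly decreasing, so a weak ascent at the junction already ends the run. The default
    0 of [last] and [head] is never read, as [d] is nonempty and the inequality is guarded. *)
Lemma ldp_cat d t :
  sorted gtn d -> d <> [::] -> (t <> [::] -> last 0 d <= head 0 t) ->
  ldp (d ++ t) = d.
Proof.
case: d => [|x d] // srt _; elim: d x srt => [|y d IH] x /=.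
  by case: t => [|y t] //= _ le_t; rewrite ltnNge le_t.
by case/andP=> lt_yx srt le_t; rewrite lt_yx -(IH y).
Qed.

Lemma ldp_catK w : ldp w ++ drop (size (ldp w)) w = w.
Proof.
by have /prefixP[v eq_w] := ldp_prefix w; rewrite {3 4}eq_w drop_size_cat.
Qed.

Lemma ldp_consE x w : ldp (x :: w) = x :: behead (ldp (x :: w)).
Proof. by []. Qed.

Lemma ldp_split x w : exists d r, w = d ++ r /\ ldp (x :: d ++ r) = x :: d.
Proof.
exists (behead (ldp (x :: w))), (drop (size (ldp (x :: w))) (x :: w)).
suff eq_w : behead (ldp (x :: w)) ++ drop (size (ldp (x :: w))) (x :: w) = w.
  by rewrite eq_w -ldp_consE.
by have := ldp_catK (x :: w); rewrite {1}ldp_consE => -[].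
Qed.

Lemma pop_ldp u v : ldp (u ++ v) = u -> pop (u ++ v) = rev u ++ pop v.
Proof. by move=> eq_u; rewrite popE eq_u drop_size_cat. Qed.

Lemma pop_ltn_head x v : (v <> [::] -> x < head 0 v) -> pop (x :: v) = x :: pop v.
Proof. by move=> lt_x; apply: (@pop_ldp [:: x]); apply: ldp_cat => // /lt_x/ltnW. Qed.

(** Being below every other letter, [m] extends the run [u] and cannot be followed by a descent. *)
Lemma pop_min m u v :
    sorted gtn u -> all (ltn m) u -> all (ltn m) v ->
  pop (u ++ m :: v) = m :: rev u ++ pop v.
Proof.
move=> srt_u lt_u lt_v; rewrite -cat_rcons pop_ldp ?rev_rcons //.
apply: ldp_cat; rewrite ?last_rcons; last 2 first.
- by case: (u).
- by case: v lt_v => //= y v /andP[/ltnW].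
case: u srt_u lt_u => // x u srt_u /allP lt_u.
by rewrite rcons_cons /= rcons_path [path _ _ _]srt_u; exact/lt_u/mem_last.
Qed.

Lemma perm_pop w : perm_eq (pop w) w.
Proof.
have [k le_k] := ubnP (size w); elim: k => // k IH in w le_k *.
case: w le_k => // x w le_k; rewrite popE -[X in perm_eq _ X]ldp_catK.
by rewrite perm_cat ?perm_rev //; apply: IH; move: le_k; rewrite /= size_drop; lia.
Qed.

Lemma mem_pop w : pop w =i w.
Proof. exact: perm_mem (perm_pop w). Qed.

(** * Invariance under order-preserving relabelling *)

Lemma ldp_map f w :
  {in w &, {mono f : x y / x < y}} -> ldp [seq f x | x <- w] = [seq f x | x <- ldp w].
Proof.
elim: w => [|x [|y w] IH] // mono_f.
rewrite !map_cons !ldp_cons2 mono_f ?inE ?eqxx ?orbT //.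
case: ltnP => // _; rewrite -map_cons IH // => a b a_w b_w.
by rewrite mono_f // in_cons ?a_w ?b_w orbT.
Qed.

Lemma pop_map f w :
  {in w &, {mono f : x y / x < y}} -> pop [seq f x | x <- w] = [seq f x | x <- pop w].
Proof.
have [k le_k] := ubnP (size w); elim: k => // k IH in w le_k *.
case: w le_k => // x w le_k mono_f.
rewrite popE [pop (x :: w)]popE ldp_map // map_cat map_rev size_map -map_drop IH //.
  by move: le_k; rewrite /= size_drop; lia.
by move=> a b /mem_drop a_w /mem_drop b_w; apply: mono_f.
Qed.

Definition layered w := sorted ltn (pop w).

Lemma layered_map f w :
  {in w &, {mono f : x y / x < y}} -> layered [seq f x | x <- w] = layered w.
Proof.
move=> mono_f; rewrite /layered pop_map //.
apply: (mono_sorted_in (P := mem w) mono_f).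
by apply/allP => x; rewrite mem_pop.
Qed.

(** Stated for arbitrary words, so that it applies to parts of a permutation without passing through
    [red]. *)
Definition sortable2 w := layered (pop w).

Lemma sortable2_map f w :
  {in w &, {mono f : x y / x < y}} -> sortable2 [seq f x | x <- w] = sortable2 w.
Proof.
move=> mono_f; rewrite /sortable2 pop_map // layered_map // => x y.
by rewrite !mem_pop; apply: mono_f.
Qed.

(** A strictly increasing word whose letters are 1, ..., n must be [iota 1 n]. *)
Lemma P2E n w : (w \in P2 n) = (w \in Sn n) && sortable2 w.
Proof.
rewrite unfold_in; case: (boolP (w \in Sn n)) => //= w_n.
have perm_w : perm_eq (pop (pop w)) (iota 1 n).
  by rewrite (perm_trans (perm_pop _)) // (perm_trans (perm_pop _)).
apply/eqP/idP => [eq_w | srt_w].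
  by rewrite /sortable2 /layered eq_w iota_ltn_sorted.
apply: (irr_sorted_eq ltn_trans ltnn) => //; first exact: iota_ltn_sorted.
exact: perm_mem.
Qed.

Lemma red_mono w :
  {in w &, {mono (fun x => (index x (sort leq w)).+1) : x y / x < y}}.
Proof.
move=> x y x_w y_w; rewrite ltnS.
have srt : sorted leq (sort leq w) by apply: sort_sorted; exact: leq_total.
have lt_index a b : a \in w -> b \in w -> a < b ->
    index a (sort leq w) < index b (sort leq w).
  move=> a_w b_w; apply: contraTT; rewrite -!leqNgt => le_ba.
  have := sorted_leq_nth leq_trans leqnn 0 srt.
  move=> /(_ (index b (sort leq w)) (index a (sort leq w))).
  by rewrite !inE !index_mem !mem_sort !nth_index ?mem_sort // => ->.
case: (ltngtP x y) => [lt_xy|lt_yx|->]; last by rewrite ltnn.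
  exact: lt_index.
by apply/negbTE; rewrite -leqNgt ltnW // lt_index.
Qed.

Lemma red_Sn w : uniq w -> red w \in Sn (size w).
Proof.
move=> uniq_w; rewrite unfold_in.
have perm_s : perm_eq (sort leq w) w by rewrite perm_sort.
rewrite (perm_trans (perm_map _ (_ : perm_eq w (sort leq w)))) 1?perm_sym //.
rewrite (map_comp S (index^~ (sort leq w))).
have -> : [seq index x (sort leq w) | x <- sort leq w] = iota 0 (size w).
  rewrite -(size_sort leq w).
  apply: (@eq_from_nth _ 0); rewrite ?size_map ?size_iota // => i lt_i.
  by rewrite (nth_map 0) // nth_iota // index_uniq // sort_uniq.
by rewrite -(iotaDl 1 0).
Qed.

Lemma red_P2 n w : uniq w -> size w = n -> (red w \in P2 n) = sortable2 w.
Proof.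
move=> uniq_w <-; rewrite P2E red_Sn //=.
by apply: sortable2_map; exact: red_mono.
Qed.

(** * Structure of layered words *)

Lemma rev_ldp_sorted w : sorted ltn (rev (ldp w)).
Proof. by rewrite rev_sorted ldp_sorted. Qed.

Lemma ldp_max x w y : y \in ldp (x :: w) -> y <= x.
Proof.
have gtn_trans : transitive gtn by move=> b a c /= lt_ba /ltn_trans; apply.
have := ldp_sorted (x :: w); rewrite ldp_consE /= (path_sortedE gtn_trans).
by case/andP=> /allP lt_x _; rewrite inE => /predU1P[->|/lt_x/ltnW].
Qed.

(** The reversed first run is increasing and ends with its maximum [c], so only the comparison of
    [c] with later letters remains. *)
Lemma layered_ldp c d t :
  ldp (c :: d ++ t) = c :: d ->
  layered (c :: d ++ t) = all (ltn c) t && layered t.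
Proof.
move=> eq_d; rewrite /layered (@pop_ldp (c :: d)) //.
have := rev_ldp_sorted (c :: d ++ t); rewrite eq_d.
have max_d y : y \in c :: d -> y <= c by rewrite -eq_d; exact: ldp_max.
rewrite !(sorted_pairwise ltn_trans) pairwise_cat => ->.
congr (_ && _); apply/allrelP/allP => [lt_t y y_t | lt_t x y].
  by apply: lt_t; rewrite ?mem_rev ?mem_head ?mem_pop.
by rewrite mem_rev mem_pop => /max_d le_xc /lt_t; apply: leq_ltn_trans.
Qed.

Lemma layered_min x t : all (ltn x) t -> layered (x :: t) = layered t.
Proof.
move=> lt_t; rewrite (@layered_ldp x [::]) ?lt_t // cat0s.
by case: t lt_t => //= y t /andP[/ltnW]; rewrite leqNgt; case: (y < x).
Qed.

Lemma layered_descent c t y : layered (c :: t) -> y \in t -> y < c -> y \in ldp (c :: t).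
Proof.
have [d [r [-> eq_d]]] := ldp_split c t.
rewrite layered_ldp // eq_d => /andP[/allP lt_r _].
rewrite mem_cat inE => /orP[->|/lt_r /= lt_cy]; first by rewrite orbT.
by rewrite ltnNge ltnW.
Qed.

(** Either [c] is a run by itself, or its run merely loses its maximum, and letters above [c] are
    above the new maximum too. *)
Lemma layered_behead c t : layered (c :: t) -> layered t.
Proof.
case: t => // y t; have [d [r [-> eq_d]]] := ldp_split y t.
case: (ltnP y c) => [lt_yc|le_cy]; last first.
  by rewrite (@layered_ldp c [::]) ?cat0s ?ldp_cons2 ?ltnNge ?le_cy //= => /andP[].
rewrite (@layered_ldp c (y :: d)) /= ?lt_yc; last by rewrite -[RHS](congr1 (cons c) eq_d).
rewrite (layered_ldp eq_d) => /andP[lt_r ->]; rewrite andbT.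
by apply: sub_all lt_r => z /=; exact: ltn_trans.
Qed.

Lemma ldp_last x d r : ldp (x :: d ++ r) = x :: d -> r <> [::] -> last x d <= head 0 r.
Proof.
elim: d x => [|y d IH] x.
  by case: r => // y r; rewrite cat0s ldp_cons2; case: ltnP.
by rewrite cat_cons ldp_cons2; case: ltnP => // _ /(congr1 behead)/IH.
Qed.

(** If the first run of [v] has at least two letters, then in [pop v] its last letter is followed by
    a larger one, hence is a run by itself. *)
Lemma pop_head v :
  v <> [::] -> exists t, pop v = last 0 (ldp v) :: t /\
    (ldp v = [:: last 0 (ldp v)] \/ ldp (last 0 (ldp v) :: t) = [:: last 0 (ldp v)]).
Proof.
case: v => // x v _; have [d [r [-> eq_d]]] := ldp_split x v.
have := ldp_sorted (x :: d ++ r).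
rewrite (@pop_ldp (x :: d)) // eq_d; case/lastP: d {eq_d} => [|d l] /=.
  by exists (pop r); split; [|left].
rewrite last_rcons rcons_path => /andP[_ /= lt_l].
rewrite -rcons_cons rev_rcons (lastI x d) rev_rcons /=; eexists; split; first by [].
by right; rewrite /= ltnNge ltnW.
Qed.

(** The word starts with [c], so a smaller [y] must lie in its first run. A nonempty [d] would put a
    larger letter right after [c] and end that run. So the run goes straight into [pop v], where by
    [pop_head] it stops at the first letter unless the first run of [v] is a single letter. *)
Lemma layered_rev_pop d c v y :
    sorted gtn (rcons d c) -> layered (rev (rcons d c) ++ pop v) ->
    y \in v -> y < c ->
  d = [::] /\ (y = last 0 (ldp v) \/ exists2 b, ldp v = [:: b] & b < c).
Proof.
move=> srt_d lay y_v lt_yc; have v_nil : v <> [::] by case: (v) y_v.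
move: lay; rewrite rev_rcons => /layered_descent/(_ _ lt_yc).
rewrite mem_cat mem_pop y_v orbT => /(_ isT).
have [t [-> ldp_v]] := pop_head v_nil; set l := last 0 _ in ldp_v *.
case/lastP: d srt_d => [|d z]; last first.
  rewrite -rev_sorted !rev_rcons /= => /andP[lt_cz _].
  by rewrite ltnNge ltnW //= inE ltn_eqF.
move=> _; rewrite (ldp_cons2 c l t) in_cons (ltn_eqF lt_yc) orFb.
case: ltnP => // lt_lc y_l; split=> //.
case: ldp_v => eq_l; [by right; exists l | left].
by move: y_l; rewrite eq_l inE => /eqP.
Qed.

Lemma layered_join u v :
    uniq v -> sorted gtn u -> u <> [::] -> layered (rev u ++ pop v) ->
  ldp (u ++ v) = u \/
  exists c b w, [/\ u = [:: c], v = b :: w, b < c & w <> [::] -> b < head 0 w].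
Proof.
case/lastP: u => // u c; case: v => [|b w] uniq_v srt_u _ lay.
  by left; apply: ldp_cat => //; case: (u).
case: (leqP c b) => [le_cb | lt_bc].
  by left; apply: ldp_cat => //; [case: (u) | rewrite last_rcons].
have [-> ldp_v] := layered_rev_pop srt_u lay (mem_head b w) lt_bc.
right; exists c, b, w; split=> //.
have [d [r [eq_w eq_d]]] := ldp_split b w.
(* If [b] begins a longer run, [layered_rev_pop] makes [b] also the last letter of that run, against
   distinctness. *)
suff d_nil : d = [::].
  have ldp_b : ldp (b :: w) = [:: b] by rewrite eq_w eq_d d_nil.
  move=> w_nil; have := @ldp_last b [::] w ldp_b w_nil.
  case: (w) w_nil uniq_v => // h w' _ /=; rewrite inE negb_or ltn_neqAle.
  by case/andP=> /andP[-> _].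
move: ldp_v; rewrite eq_w eq_d => -[|[? [_ ->]]] //=.
case/lastP: d eq_w {eq_d} => // d l eq_w; rewrite last_rcons => eq_l.
by move: uniq_v; rewrite eq_w eq_l /= mem_cat mem_rcons mem_head.
Qed.

(** If [u] is not decreasing, its first run is a full run of the word and [m] comes later, below all
    of it. By [layered_rev_pop] that run is a single letter and [m] ends the next run, so the rest
    of [u] is decreasing. *)
Lemma sortable2_min_pos m u v :
    all (ltn m) u -> sortable2 (u ++ m :: v) ->
  sorted gtn u \/
  exists a w, [/\ u = a :: w, w <> [::], sorted gtn w & a <= head 0 w].
Proof.
case: u => [|x u] lt_u; first by left.
have [d [r [eq_u eq_d]]] := ldp_split x u; rewrite {u}eq_u in lt_u *.
have := ldp_sorted (x :: d ++ r); rewrite eq_d.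
case: r eq_d lt_u => [|z r] eq_d lt_u srt_d; first by rewrite cats0; left.
have le_z := ldp_last eq_d; rewrite /sortable2 -cat_cons -catA pop_ldp; last first.
  by apply: ldp_cat => // _; apply: le_z.
rewrite (lastI x d) in srt_d * => lay; right.
have m_zr : m \in (z :: r) ++ m :: v by rewrite mem_cat mem_head orbT.
have lt_m : m < last x d by apply: (allP lt_u); rewrite -cat_cons mem_cat mem_last.
have [d_nil ldp_zr] := layered_rev_pop srt_d lay m_zr lt_m.
have eq_dx : d = [::] by case: (d) d_nil.
rewrite {}eq_dx in lt_u le_z ldp_zr *; exists x, (z :: r); split=> //; last exact: le_z.
have [d2 [r2 [eq_r eq_d2]]] := ldp_split z r.
have := ldp_sorted (z :: d2 ++ r2); rewrite eq_d2.
case: r2 eq_r eq_d2 => [|y r2] eq_r eq_d2; first by rewrite eq_r cats0.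
have le_y := ldp_last eq_d2; move=> srt_d2; move: ldp_zr.
rewrite eq_r -cat_cons -catA (@ldp_cat (z :: d2)) // => [|_]; last exact: le_y.
case=> [eq_m | [b [<- _]]]; last by rewrite ltnNge le_z.
have /(allP lt_u) : m \in [:: x, z & r].
  by rewrite eq_r eq_m [last 0 _]/= inE -cat_cons mem_cat mem_last orbT.
by rewrite /= ltnn.
Qed.

Lemma layered_pair b c v :
    layered (c :: b :: pop v) -> uniq (b :: v) -> b < c ->
    (v <> [::] -> b < head 0 v) ->
  all (ltn c) v \/
  [/\ 2 <= size (ldp v), last 0 (ldp v) < b
    & {in v, forall z, z = last 0 (ldp v) \/ c < z}].
Proof.
case: (v =P [::]) => [-> | v_nil]; first by left.
move=> lay uniq_v lt_bc /(_ v_nil) lt_bv.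
have [t [eq_v ldp_v]] := pop_head v_nil; move: (@mem_pop v).
rewrite eq_v in lay *; set l := last 0 _ in ldp_v lay * => mem_v.
case: (ltngtP l b) => [lt_lb | lt_bl | eq_lb].
- right; case: ldp_v => eq_l.
    (* A single-letter first run would make [l] the head of [v], which exceeds [b]. *)
    by case: (v) eq_l lt_bv lt_lb => // h w /= [<- _]; lia.
  have eq_d : ldp (c :: b :: l :: t) = [:: c; b; l].
    by rewrite !ldp_cons2 lt_bc lt_lb eq_l.
  move: lay; rewrite (@layered_ldp c [:: b; l]) // => /andP[/allP lt_t _]; split=> //.
    case: (v) @l lt_bv lt_lb {mem_v eq_v uniq_v v_nil eq_l eq_d lt_t} => // h w.
    by rewrite ldp_consE; case: (behead _) => //= ? ?; lia.
  by move=> z; rewrite -mem_v inE => /predU1P[|/lt_t]; [left|right].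
- left; move: lay; rewrite (@layered_ldp c [:: b]); last first.
    by rewrite cat1s !ldp_cons2 lt_bc ltnNge ltnW.
  by case/andP=> /allP lt_v _; apply/allP=> z; rewrite -mem_v => /lt_v.
by move: uniq_v; rewrite /= -mem_v -eq_lb mem_head.
Qed.

(** No value lies strictly between [b] and [b.+1], so the next letter is below both or above both.
    Inserting [b] then only lengthens the first run and keeps its maximum. *)
Lemma layered_consec b t :
  b \notin t -> b.+1 \notin t -> layered (b.+1 :: b :: t) = layered (b.+1 :: t).
Proof.
have ltS : b < b.+1 by [].
case: t => [|l t].
  rewrite (@layered_ldp b.+1 [:: b] [::]); last by rewrite cats0 ldp_cons2 ltS.
  by rewrite (@layered_ldp b.+1 [::] [::]).
have [d [r [-> eq_d]]] := ldp_split l t.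
rewrite !inE !negb_or => /andP[neq_bl _] /andP[neq_cl _].
case: (ltnP l b) => [lt_lb | le_bl].
  rewrite (@layered_ldp b.+1 [:: b, l & d]); last first.
    by rewrite !cat_cons !ldp_cons2 ltS lt_lb eq_d.
  rewrite (@layered_ldp b.+1 (l :: d)) // !cat_cons ldp_cons2 eq_d.
  by rewrite ltnS ltnW.
rewrite (@layered_ldp b.+1 [:: b]); last by rewrite cat1s !ldp_cons2 ltS ltnNge le_bl.
rewrite (@layered_ldp b.+1 [::]) // cat0s ldp_cons2 ifF //.
by apply/negbTE; lia.
Qed.

(** * Sortability of words split at their minimum *)

Lemma sortable2_min m v : all (ltn m) v -> sortable2 (m :: v) = sortable2 v.
Proof.
move=> lt_v; rewrite /sortable2 (@pop_min m [::]) // layered_min //=.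
by apply/allP => x; rewrite mem_pop; apply: (allP lt_v).
Qed.

Lemma P2_dsum1 n v : all (ltn 1) v -> 1 :: v \in Sn n.+1 ->
  1 :: v \in P2 n.+1 <-> exists2 p, p \in P2 n & 1 :: v = dsum [:: 1] p.
Proof.
move=> lt_v v_n; rewrite P2E v_n sortable2_min //=.
have mono_S p : sortable2 [seq 1 + x | x <- p] = sortable2 p.
  by apply: sortable2_map => x y _ _; rewrite ltn_add2l.
split=> [srt_v | [p]]; last by rewrite P2E => /andP[_ srt_p] [->]; rewrite mono_S.
(* All letters of [v] exceed 1, so taking predecessors is undone by adding 1; this gives the
   summand. *)
have eq_v : v = [seq 1 + x | x <- [seq x.-1 | x <- v]].
  rewrite -map_comp -[LHS]map_id; apply/eq_in_map => x /(allP lt_v) /=; lia.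
exists [seq x.-1 | x <- v]; last by rewrite /dsum /= {1}eq_v.
rewrite P2E -mono_S -eq_v srt_v andbT unfold_in.
apply: (perm_map_inj (@addnI 1)); rewrite -eq_v -iotaDl.
by move: v_n; rewrite unfold_in /= perm_cons.
Qed.

Lemma sortable2_run u m v :
    sorted gtn u -> all (ltn m) (u ++ v) ->
  sortable2 (u ++ m :: v) = layered (rev u ++ pop v).
Proof.
rewrite all_cat => srt_u /andP[lt_u lt_v].
rewrite /sortable2 pop_min // layered_min // all_cat all_rev lt_u.
by rewrite (perm_all _ (perm_pop v)).
Qed.

(** Here [a] is a run by itself, and one application of [pop] gives [a :: m :: rev u ++ pop v],
    whose first run is [a m]. *)
Lemma sortable2_cons_run a u m v :
    m < a -> a <= head 0 u -> sorted gtn u -> all (ltn m) (u ++ v) ->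
  sortable2 (a :: u ++ m :: v) = all (ltn a) (u ++ v) && layered (rev u ++ pop v).
Proof.
rewrite all_cat => lt_ma le_a srt_u /andP[lt_u lt_v].
have eq_a : ldp ([:: a] ++ u ++ m :: v) = [:: a].
  apply: ldp_cat => // _; case: (u) le_a => //=.
  (* For empty [u] the default head 0 forces [a] to be 0, against [m < a]. *)
  by rewrite leqn0 => /eqP eq_a; rewrite eq_a in lt_ma.
rewrite /sortable2 -cat1s pop_ldp // pop_min // [rev _ ++ _]/=.
have lt_uv : all (ltn m) (rev u ++ pop v).
  by rewrite all_cat all_rev lt_u (perm_all _ (perm_pop v)).
have eq_am : ldp (a :: [:: m] ++ rev u ++ pop v) = [:: a; m].
  apply: (@ldp_cat [:: a; m]) => //=; first by rewrite lt_ma.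
  by case: (rev u ++ _) lt_uv => //= x s /andP[/ltnW].
rewrite (layered_ldp eq_am); congr (_ && _).
by rewrite !all_cat all_rev (perm_all _ (perm_pop v)).
Qed.

(** The values 1, ..., k are all used up in [s], so by distinctness none is left for [w]. *)
Lemma all_gt_iota k s w :
  uniq (s ++ w) -> all (mem s) (iota 1 k) -> all (ltn 0) w -> all (ltn k) w.
Proof.
rewrite cat_uniq => /and3P[_ /hasPn s_w _] /allP iota_s /allP gt0_w.
apply/allP=> x x_w /=; rewrite ltnNge; apply: contra (s_w x x_w) => le_xk.
by apply: iota_s; rewrite mem_iota add1n ltnS le_xk [0 < x]gt0_w.
Qed.

Lemma Sn_split1 n u v :
    u ++ 1 :: v \in Sn n ->
  [/\ uniq (1 :: u ++ v), all (ltn 1) (u ++ v), size (u ++ v) = n - 1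
    & forall x, (x \in 1 :: u ++ v) = (0 < x <= n)].
Proof.
rewrite unfold_in -cat1s perm_catCA cat1s => perm_uv.
have mem_uv x : (x \in 1 :: u ++ v) = (0 < x <= n).
  by rewrite (perm_mem perm_uv) mem_iota add1n ltnS.
have uniq_uv : uniq (1 :: u ++ v) by rewrite (perm_uniq perm_uv) iota_uniq.
split=> //; last by have := perm_size perm_uv; rewrite size_iota /=; lia.
apply: (@all_gt_iota 1 [:: 1]) => //=; apply/allP => x x_uv /=.
by have := mem_uv x; rewrite in_cons x_uv orbT => /esym/andP[].
Qed.

(** * Necessity: the shapes forced on a sortable permutation *)

(** The first outcome of [layered_join] gives case 2. The second leaves [c :: b :: pop w], and the
    two outcomes of [layered_pair] give cases 3 and 4. *)
Lemma P2_run u v n :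
    4 <= n -> u ++ 1 :: v \in P2 n -> u <> [::] -> sorted gtn u ->
  [\/ ldp (u ++ v) = u /\ red (u ++ v) \in P2 (n - 1),
      exists w, u ++ 1 :: v = [:: 3, 1, 2 & w] /\ red w \in P2 (n - 3)
    | exists w,
      [/\ u ++ 1 :: v = [:: 4, 1, 3 & w],
          exists d e : seq nat,
            [/\ w = d ++ e, 2 <= size d, sorted gtn d & last 0 d = 2]
        & red w \in P2 (n - 3)]].
Proof.
move=> n_ge4; rewrite P2E => /andP[uv_n srt_uv] u_nil srt_u.
have [uniq_1uv gt1_uv size_uv mem_uv] := Sn_split1 uv_n.
have uniq_uv : uniq (u ++ v) by case/andP: uniq_1uv.
have /and3P[_ _ uniq_v] : [&& uniq u, ~~ has (mem u) v & uniq v] by rewrite -cat_uniq.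
rewrite sortable2_run // in srt_uv.
case: (layered_join uniq_v srt_u u_nil srt_uv) => [ldp_uv | [c [b [w]]]].
  by constructor 1; rewrite red_P2 // /sortable2 pop_ldp.
case=> eq_u eq_v lt_bc lt_bw; subst u v; rewrite [rev _ ++ _]/= pop_ltn_head // in srt_uv.
have [gt1_c gt1_b] : 1 < c /\ 1 < b by case/and3P: gt1_uv.
have uniq_w : uniq w by case/and3P: uniq_uv.
have red_w : red w \in P2 (n - 3).
  rewrite red_P2 //; last by move: size_uv => /=; lia.
  exact/layered_behead/layered_behead/srt_uv.
have mem_w x : 1 < x <= n -> [|| x == c, x == b | x \in w].
  case/andP=> gt1_x le_xn; have := mem_uv x.
  by rewrite cat1s !inE gtn_eqF // le_xn ltnW.
case: (layered_pair srt_uv uniq_v lt_bc lt_bw) => [/allP lt_cw | [size_d lt_db lt_w]].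
  have {}mem_w x : 1 < x <= n -> [|| x == c, x == b | c < x].
    by move/mem_w/or3P=> [->|->|/lt_cw/= ->]; rewrite ?orbT.
  constructor 2; exists w; split=> //.
  (* The values 2 and 3 both occur, but apart from 1 only [b] and [c] do not exceed [c]. *)
  have [b_2 c_3] : b = 2 /\ c = 3 by have := mem_w 2; have := mem_w 3; lia.
  by rewrite b_2 c_3.
have gt1_d : 1 < last 0 (ldp w).
  have w_nil : w <> [::] by case: (w) size_d.
  have [t [eq_w _]] := pop_head w_nil.
  apply: (allP gt1_uv); rewrite cat1s !in_cons -(mem_pop w) eq_w mem_head.
  by rewrite !orbT.
have {}mem_w x : 1 < x <= n -> [|| x == c, x == b, x == last 0 (ldp w) | c < x].
  move/mem_w/or3P=> [->|->|/lt_w[->|->]]; rewrite ?eqxx ?orbT //.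
(* Three letters other than 1 do not exceed [c], in the order [l < b < c] with [l] the last letter
   of [ldp w]; they must be 2, 3 and 4. *)
have [d_2 [b_3 c_4]] : last 0 (ldp w) = 2 /\ b = 3 /\ c = 4.
  by have := mem_w 2; have := mem_w 3; have := mem_w 4; lia.
constructor 3; exists w; split=> //; first by rewrite b_3 c_4.
exists (ldp w), (drop (size (ldp w)) w); rewrite ldp_catK; split=> //.
exact: ldp_sorted.
Qed.

(** Again by [layered_join]: a clean junction gives case 6, and a descent there gives case 5. *)
Lemma P2_cons_run a u v n :
    4 <= n -> a :: u ++ 1 :: v \in P2 n -> u <> [::] -> sorted gtn u ->
    a <= head 0 u ->
  (exists c w,
    [/\ a :: u ++ 1 :: v = [:: 2, c, 1, c - 1 & w],
        w <> [::] -> c < head 0 w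
      & red (c :: w) \in P2 (n - 3)])
  \/ [/\ a = 2, ldp (u ++ v) = u, red (u ++ v) \in P2 (n - 2)
       & size u = 1 -> head 0 u < head 0 v].
Proof.
move=> n_ge4; rewrite P2E -cat_cons => /andP[auv_n srt_auv] u_nil srt_u le_au.
have [] := Sn_split1 auv_n; rewrite cat_cons => uniq_1auv gt1_auv size_auv mem_auv.
have [gt1_a gt1_uv] : 1 < a /\ all (ltn 1) (u ++ v) by case/andP: gt1_auv.
have [notin_a uniq_uv] : a \notin u ++ v /\ uniq (u ++ v) by case/and3P: uniq_1auv.
have /and3P[_ _ uniq_v] : [&& uniq u, ~~ has (mem u) v & uniq v] by rewrite -cat_uniq.
rewrite cat_cons sortable2_cons_run // in srt_auv.
case/andP: srt_auv => /allP gt_a srt_uv.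
(* The value 2 occurs, and every letter other than 1 and [a] exceeds [a]. *)
have a_2 : a = 2.
  have := mem_auv 2; rewrite 2!in_cons (_ : 0 < 2 <= n); last by lia.
  by case/or3P=> [//|/eqP//|/gt_a /=]; lia.
rewrite {a}a_2 in notin_a auv_n size_auv mem_auv uniq_1auv gt1_auv gt1_a gt_a le_au *.
case: (layered_join uniq_v srt_u u_nil srt_uv) => [ldp_uv | [c [b [w]]]].
  right; split=> //.
    by rewrite red_P2 ?/sortable2 ?pop_ldp //; move: size_auv => /=; lia.
  (* For a one-letter [u], [v] is nonempty because [4 <= n], and distinct letters turn the weak
     ascent into a strict one. *)
  move: ldp_uv size_auv uniq_uv; case: (u) => [|x [|? ?]] //.
  move=> ldp_xv size_xv /andP[notin_x _] _; have := @ldp_last x [::] v ldp_xv.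
  case: (v) size_xv notin_x => [/=|h v' _]; first by lia.
  by rewrite in_cons negb_or ltn_neqAle => /andP[-> _] ->.
case=> eq_u eq_v lt_bc lt_bw; subst u v; rewrite [rev _ ++ _]/= pop_ltn_head // in srt_uv.
have [gt2_c gt2_b] : 2 < c /\ 2 < b.
  by split; apply: gt_a; rewrite cat1s !inE eqxx ?orbT.
(* If [c.-1] were in [w], it would lie in the first run of [c :: b :: pop w] after [c], hence be at
   most [b]. *)
have b_c : b = c.-1.
  have := mem_auv c; rewrite cat1s !in_cons eqxx !orbT => /esym/andP[_ le_cn].
  have := mem_auv c.-1; rewrite cat1s !in_cons (_ : 0 < c.-1 <= n); last by lia.
  case/or3P=> [||/or3P[||c_w]]; try lia.
  have : c.-1 \in ldp (c :: b :: pop w).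
    by apply: (layered_descent srt_uv); rewrite ?in_cons ?mem_pop ?c_w ?orbT //; lia.
  by rewrite ldp_cons2 lt_bc in_cons => /orP[|/ldp_max]; lia.
have lt_cw : w <> [::] -> c < head 0 w.
  move=> w_nil; move/(_ w_nil): lt_bw.
  have : head 0 w != c.
    apply: contraTneq uniq_uv => <-; rewrite cat1s cons_uniq in_cons.
    by case: (w) w_nil => //= h w' _; rewrite mem_head orbT.
  lia.
left; exists c, w; split=> //; first by rewrite subn1 -b_c.
rewrite red_P2.
- rewrite /sortable2 pop_ltn_head //.
  have eq_c : c = b.+1 by lia.
  rewrite eq_c in srt_uv uniq_uv *; rewrite -layered_consec ?mem_pop //.
    by case/and3P: uniq_uv.
  by move: uniq_uv; rewrite cat1s cons_uniq in_cons negb_or => /andP[/andP[]].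
- by move: uniq_uv; rewrite cat1s !cons_uniq in_cons negb_or => /and3P[/andP[_ ->] _].
by move: size_auv => /=; lia.
Qed.

(** * Sufficiency of the special prefixes *)

Lemma sortable2_312 w : all (ltn 3) w -> sortable2 [:: 3, 1, 2 & w] = sortable2 w.
Proof.
move=> gt3_w; have gt_w k : k <= 3 -> all (ltn k) w.
  by move=> le_k3; apply: sub_all gt3_w => x; apply: leq_ltn_trans.
rewrite (@sortable2_run [:: 3] 1 (2 :: w)) /= ?gt_w // pop_ltn_head; last first.
  by case: (w) (gt_w 2 isT) => //= h t /andP[].
rewrite layered_consec ?mem_pop ?layered_min ?(perm_all _ (perm_pop w)) //.
  by apply/negP => /(allP gt3_w).
by apply/negP => /(allP gt3_w).
Qed.

(** What must be layered is [4 :: 3 :: pop w]. By [layered_consec] the 3 can be deleted, and then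
    [4 2] is the first run, since [pop w] starts with 2 followed by an ascent or nothing. *)
Lemma sortable2_413 d e :
    2 <= size d -> sorted gtn d -> last 0 d = 2 -> uniq [:: 4, 1, 3 & d ++ e] ->
    all (ltn 1) (d ++ e) ->
  sortable2 (d ++ e) -> sortable2 [:: 4, 1, 3 & d ++ e].
Proof.
move=> size_d srt_d last_d uniq_w gt1_w; set w := d ++ e in uniq_w gt1_w *.
have w_nil : w <> [::] by rewrite /w; case: (d) size_d.
have ldp_w : ldp w = d.
  apply: ldp_cat => // [|e_nil]; first by case: (d) size_d.
  rewrite last_d; apply: (allP gt1_w); rewrite mem_cat orbC.
  by case: (e) e_nil => //= h t _; rewrite mem_head.
have [t []] := pop_head w_nil; rewrite ldp_w last_d => pop_w.
case=> [eq_d | ldp_t]; first by rewrite eq_d in size_d.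
have perm_w : perm_eq (2 :: t) w by rewrite -pop_w perm_pop.
have uniq_t : uniq ([:: 4; 1; 3; 2] ++ t).
  by rewrite -(perm_uniq (_ : perm_eq ([:: 4; 1; 3] ++ w) _)) ?perm_cat2l 1?perm_sym.
have gt4_t : all (ltn 4) t.
  apply: all_gt_iota uniq_t _ _ => //; move: gt1_w; rewrite -(perm_all _ perm_w).
  by case/andP=> _; apply: sub_all => x; apply: ltnW.
have [notin_4 notin_3] : 4 \notin w /\ 3 \notin w.
  by move: uniq_w; rewrite /= !inE !negb_or => /and4P[/and3P[_ _ ->] _ ->].
(* The head of [w] is 2 or exceeds 4; it cannot be 2, because 2 already ends [d], which has at least
   two letters. *)
have gt3_w : 3 < head 0 w.
  have : head 0 w \in 2 :: t.
    by rewrite (perm_mem perm_w); case: (w) w_nil => //= h ? _; rewrite mem_head.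
  rewrite inE => /predU1P[head_w|/(allP gt4_t)/ltnW//].
  move: uniq_w head_w last_d size_d; rewrite /w; case: (d) => // h [|h' d'] //.
  rewrite /= => /and4P[_ _ _ /andP[notin_h _]] eq_h eq_d _; case/negP: notin_h.
  by rewrite eq_h -eq_d -cat_cons mem_cat mem_last.
rewrite {1}/sortable2 pop_w => lay_t.
rewrite (@sortable2_run [:: 4] 1 (3 :: w)) //.
rewrite pop_ltn_head // layered_consec ?mem_pop //.
rewrite pop_w (@layered_ldp 4 [:: 2]) ?gt4_t ?(layered_behead lay_t) //.
by rewrite cat1s ldp_cons2 ldp_t.
Qed.

(** After [sortable2_cons_run] the word left is [c :: c.-1 :: pop w], from which [layered_consec]
    deletes [c.-1]. *)
Lemma sortable2_2c1 c w :
    3 < c -> all (ltn 2) w -> c \notin w -> c.-1 \notin w ->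
    (w <> [::] -> c < head 0 w) ->
  sortable2 [:: 2, c, 1, c - 1 & w] = sortable2 (c :: w).
Proof.
case: c => // c gt3_c gt2_w notin_w notin_w' lt_cw; rewrite subn1.
have gt1_w : all (ltn 1) w by apply: sub_all gt2_w => x; apply: ltnW.
rewrite (@sortable2_cons_run 2 [:: c.+1] 1 (c :: w)) //; first last.
- by rewrite /= gt1_w; lia.
- by rewrite /=; lia.
rewrite /sortable2 pop_ltn_head; last by move/lt_cw; apply: ltnW.
rewrite pop_ltn_head //.
rewrite layered_consec ?mem_pop //= gt2_w; lia.
Qed.

Theorem theorem3 (n : nat) (pi : seq nat) (hn : 4 <= n) (hpi : pi \in Sn n) :
  (pi \in P2 n) <->
  ( (exists2 pihat, pihat \in P2 (n - 1) & pi = dsum [:: 1] pihat)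
  \/
    (exists (i : nat) (u v : seq nat),
      [/\ 2 <= i, size u = i - 1, pi = u ++ 1 :: v,
          ldp (u ++ v) = u & red (u ++ v) \in P2 (n - 1)])
  \/
    (exists w : seq nat,
      pi = [:: 3, 1, 2 & w] /\ red w \in P2 (n - 3))
  \/
    (exists w : seq nat,
      [/\ pi = [:: 4, 1, 3 & w],
          exists d e : seq nat,
            [/\ w = d ++ e, 2 <= size d, sorted gtn d & last 0 d = 2]
        & red w \in P2 (n - 3)])
  \/
    (exists (p2 : nat) (w : seq nat),
      [/\ pi = [:: 2, p2, 1, p2 - 1 & w],
          w <> [::] -> p2 < head 0 w
        & red (p2 :: w) \in P2 (n - 3)])
  \/
    (* u must be a maximal decreasing run of u ++ v, not merely decreasing:
       otherwise the word 25413, which is not two-pop-stack sortable,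
       would qualify. *)
    (exists (i : nat) (u v : seq nat),
      [/\ 3 <= i /\ size u = i - 2, pi = 2 :: u ++ 1 :: v,
          ldp (u ++ v) = u, red (u ++ v) \in P2 (n - 2)
        & i = 3 -> head 0 u < head 0 v]) ).
Proof.
have [k eq_n] : exists k, n = k.+1 by exists n.-1; lia.
split=> [pi_P2 | ].
  have : 1 \in pi by rewrite (perm_mem hpi) mem_iota; lia.
  move=> one_pi; case/splitPr: one_pi => u v in hpi pi_P2 *.
  have [uniq_1uv gt1_uv size_uv mem_uv] := Sn_split1 hpi.
  move: gt1_uv; rewrite all_cat => /andP[gt1_u gt1_v].
  have := pi_P2; rewrite P2E hpi => /(sortable2_min_pos gt1_u).
  case=> [srt_u | [a [w [eq_u w_nil srt_w le_aw]]]].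
    have [u_nil | /eqP u_nil] := eqVneq u [::].
      by left; rewrite u_nil eq_n subn1 in hpi pi_P2 *; apply/P2_dsum1.
    case: (P2_run hn pi_P2 u_nil srt_u) => [[ldp_uv red_uv]||].
    - right; left; exists (size u).+1, u, v; split=> //; last by rewrite subn1.
      by case: (u) u_nil.
    - by do 2!right; left.
    - by do 3!right; left.
  rewrite {}eq_u cat_cons in pi_P2 *.
  case: (P2_cons_run hn pi_P2 w_nil srt_w le_aw) => [|[a_2 ldp_wv red_wv lt_wv]].
    by do 4!right; left.
  (* The witness is the position of 1, which comes after the leading 2 and all of [w]. *)
  do 5!right; exists (size w).+2, w, v; rewrite subn2 a_2; split=> //.
  - by split=> //; case: (w) w_nil.
  - by case; apply: lt_wv.
have size_pi : size pi = n by rewrite (perm_size hpi) size_iota.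
have uniq_pi : uniq pi by rewrite (perm_uniq hpi) iota_uniq.
have gt0_pi : all (ltn 0) pi.
  by apply/allP => x; rewrite (perm_mem hpi) mem_iota => /andP[].
case=> [[p p_P2 eq_pi] | ].
  rewrite eq_pi eq_n subn1 /= in hpi p_P2 *.
  have [_ gt1_p _ _] := @Sn_split1 _ [::] _ hpi.
  by apply/(P2_dsum1 gt1_p hpi); exists p.
case=> [[_ [u [v [_ _ eq_pi ldp_uv]]]] | ].
  rewrite {}eq_pi in hpi *; have [/andP[_ uniq_uv] gt1_uv size_uv _] := Sn_split1 hpi.
  rewrite red_P2 // P2E hpi sortable2_run //.
    by rewrite /sortable2 pop_ldp.
  by rewrite -ldp_uv ldp_sorted.
case=> [[w [eq_pi]] | ].
  rewrite {}eq_pi in hpi size_pi uniq_pi gt0_pi *.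
  rewrite red_P2; [|by case/and4P: uniq_pi | by rewrite -size_pi /= !subSS subn0].
  rewrite P2E hpi sortable2_312 //.
  by apply: (@all_gt_iota 3 [:: 3; 1; 2]) => //; case/and4P: gt0_pi.
case=> [[w [eq_pi [d [e [eq_w size_d srt_d last_d]]]]] | ].
  rewrite {}eq_pi {}eq_w in hpi size_pi uniq_pi gt0_pi *.
  rewrite red_P2; [|by case/and4P: uniq_pi | by rewrite -size_pi /= !subSS subn0].
  have [_ /and3P[_ _ gt1_w] _ _] := @Sn_split1 _ [:: 4] _ hpi.
  by rewrite P2E hpi; apply: sortable2_413.
case=> [[c [w [eq_pi lt_cw]]] | [i [u [v [[ge3_i size_u] eq_pi ldp_uv + _]]]]].
  rewrite {}eq_pi in hpi size_pi uniq_pi gt0_pi *.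
  have notin_w : c \notin w.
    by move: uniq_pi; rewrite cons_uniq cons_uniq !inE !negb_or => /and3P[_ /and3P[]].
  have notin_w' : c - 1 \notin w by case/and5P: uniq_pi.
  have gt2_w : all (ltn 2) w.
    apply: (@all_gt_iota 2 [:: 1; 2]) => //; last by case/and5P: gt0_pi.
    move: uniq_pi; rewrite /= !inE !negb_or => /and5P[/and4P[_ _ _ ->]].
    by move=> _ /andP[_ ->] _ ->.
  (* The letters 2, [c], 1 and [c - 1] are distinct and positive, which excludes every smaller
     [c]. *)
  have gt3_c : 3 < c.
    move: uniq_pi gt0_pi; rewrite /= !inE !negb_or; lia.
  rewrite red_P2; last by rewrite -size_pi /= !subSS subn0.
    2: by rewrite /= notin_w; case/and5P: uniq_pi.
  by rewrite P2E hpi sortable2_2c1 // -subn1.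
rewrite {}eq_pi in hpi size_pi uniq_pi gt0_pi *.
have [/andP[notin_1 uniq_2] gt1_uv size_uv _] := @Sn_split1 _ (2 :: u) v hpi.
have {}gt1_uv : all (ltn 1) (u ++ v) by case/andP: gt1_uv.
have uniq_12 : uniq ([:: 1; 2] ++ (u ++ v)) by apply/andP; split.
have gt2_uv : all (ltn 2) (u ++ v).
  by apply: all_gt_iota uniq_12 _ _ => //; apply: sub_all gt1_uv => x; apply: ltnW.
have srt_u : sorted gtn u by rewrite -ldp_uv ldp_sorted.
(* The default head is not reached: [size u = i - 2] with [3 <= i] makes [u] nonempty. *)
have le2_u : 2 <= head 0 u.
  case: (u) size_u gt2_uv => [/=|x s _ /andP[/ltnW]] //; lia.
rewrite red_P2; [|by case/andP: uniq_2 | by move: size_uv => /=; lia].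
by rewrite P2E hpi sortable2_cons_run // gt2_uv /sortable2 pop_ldp.
Qed.
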